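(* Let $S$ be a set, let $K_1,K_2$ be isomorphism classes of simplicial complexes over $S$, and let $n\geq0$ be an integer. If the $(n+1)$-skeletons of $K_1$ and $K_2$ differ (as isomorphism classes), then $d(K_1,K_2)\geq\frac{1}{n+2}$.
   Context: $\mathcal{P}_f^*(S)$ is the collection of all non-empty finite subsets of $S$. A simplicial complex over $S$ is a non-empty collection $\mathcal{K}\subset\mathcal{P}_f^*(S)$ such that every non-empty subset of an element of $\mathcal{K}$ belongs to $\mathcal{K}$. The $m$-skeleton of $\mathcal{K}$ is $\pi_m(\mathcal{K})=\{F\in\mathcal{K}:\#F\leq m+1\}$. $\Omega=[0,1]$ with Lebesgue measure $\lambda$. $L(\mathcal{K})$ is the set of measurable maps $f:\Omega\to S$, identified when equal almost everywhere, such that $f(\Omega)\in\mathcal{K}$, where $f(\Omega)$ denotes the set $\{s\in S : \lambda(f^{-1}(s))>0\}$ and $f$ takes its values in this set almost everywhere. The metric is $d(f,g)=\lambda(\{t\in\Omega : f(t)\neq g(t)\})$. The distance between simplicial complexes is the Hausdorff distance $d(\mathcal{K}_1,\mathcal{K}_2)=\max(\delta(\mathcal{K}_1,\mathcal{K}_2),\delta(\mathcal{K}_2,\mathcal{K}_1))$ with $\delta(\mathcal{K}_1,\mathcal{K}_2)=\sup_{f\in L(\mathcal{K}_1)}\inf_{g\in L(\mathcal{K}_2)}d(f,g)$. Let $\mathfrak{S}(S)$ be the group of all permutations of $S$, acting on simplicial complexes by $\sigma(\mathcal{K})=\{\sigma(F):F\in\mathcal{K}\}$. An isomorphism class is an orbit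 of this action, and $d(K_1,K_2)=\inf_{\mathcal{K}_1\in K_1,\,\mathcal{K}_2\in K_2}d(\mathcal{K}_1,\mathcal{K}_2)=\inf_{\sigma\in\mathfrak{S}(S)}d(\mathcal{K}_1,\sigma(\mathcal{K}_2))$ for any fixed representatives in the last expression. The $m$-skeleton of an isomorphism class $K$ is the isomorphism class of $\pi_m(\mathcal{K})$ for any $\mathcal{K}\in K$. *)

(* Defs.v *)
From HB Require Import structures.
From mathcomp Require Import all_boot all_order all_algebra.
From mathcomp Require Import generic_quotient.
From mathcomp Require Import all_classical all_reals all_analysis.

Set Implicit Arguments.
Unset Strict Implicit.
Unset Printing Implicit Defensive.

Import Order.TTheory GRing.Theory Num.Theory.
Import numFieldNormedType.Exports.

Local Open Scope classical_set_scope.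
Local Open Scope ring_scope.
Local Open Scope quotient_scope.

Section complexes.
Context {S : Type}.

Record simplicial_complex := SimplicialComplex {
  faces :> set (set S) ;
  faces_neq0 : faces !=set0 ;
  face_fin_neq0 : forall F, faces F -> finite_set F /\ F !=set0 ;
  face_sub : forall F G, faces F -> G `<=` F -> G !=set0 -> faces G }.

Lemma complex_eq (K L : simplicial_complex) :
  faces K = faces L -> K = L.
Proof.
case: K L => [K K0 Kf Ks] [L L0 Lf Ls] /= KL; subst L.
by congr SimplicialComplex; exact: Prop_irrelevance.
Qed.

Section skeleton.
Variables (m : nat) (K : simplicial_complex).

Definition skeleton_faces : set (set S) :=
  [set F | faces K F /\ (F #<= `I_m.+1)%card].

Lemma skeleton_neq0 : skeleton_faces !=set0.
Proof.
have [F KF] := faces_neq0 K; have [_ [x Fx]] := face_fin_neq0 KF.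
exists [set x]; split.
  by apply: (face_sub KF); [move=> _ ->|exists x].
apply: card_le_trans (_ : (`I_1 #<= `I_m.+1)%card).
  by rewrite (card_le_eql card_set1) card_lexx.
by rewrite card_le_II.
Qed.

Lemma skeleton_fin_neq0 F : skeleton_faces F -> finite_set F /\ F !=set0.
Proof. by case=> KF _; exact: face_fin_neq0 KF. Qed.

Lemma skeleton_sub F G :
  skeleton_faces F -> G `<=` F -> G !=set0 -> skeleton_faces G.
Proof.
case=> KF Fm GF G0; split; first exact: face_sub KF GF G0.
exact: card_le_trans (subset_card_le GF) Fm.
Qed.

Definition skeleton : simplicial_complex :=
  SimplicialComplex skeleton_neq0 skeleton_fin_neq0 skeleton_sub.

End skeleton.

Section image.
Variables (s : S -> S) (K : simplicial_complex).

Definition image_faces : set (set S) := [set s @` F | F in faces K].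

Lemma image_neq0 : image_faces !=set0.
Proof. by have [F KF] := faces_neq0 K; exists (s @` F), F. Qed.

Lemma image_fin_neq0 F : image_faces F -> finite_set F /\ F !=set0.
Proof.
case=> {}F KF <-; have [fF F0] := face_fin_neq0 KF.
by split; [exact: finite_image|exact/image_nonempty].
Qed.

Lemma image_sub F G :
  image_faces F -> G `<=` F -> G !=set0 -> image_faces G.
Proof.
case=> {}F KF <- GF [y Gy]; exists (F `&` s @^-1` G).
  apply: (face_sub KF); first by move=> x [].
  by have [x Fx sxy] := GF _ Gy; exists x; split => //=; rewrite sxy.
apply/seteqP; split => [z [x [_ ?] <-]//|z Gz].
by have [x Fx sxz] := GF _ Gz; exists x => //; split => //=; rewrite sxz.
Qed.

(* [image_complex s K] is a complex for an arbitrary map [s]; bijectivity is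
   only required in [iso_orbit]. *)
Definition image_complex : simplicial_complex :=
  SimplicialComplex image_neq0 image_fin_neq0 image_sub.

End image.

Definition iso_orbit (K : simplicial_complex) : set simplicial_complex :=
  [set image_complex s K | s in [set s : S -> S | bijective s]].

Definition iso_class (C : set simplicial_complex) : Prop :=
  exists K, C = iso_orbit K.

(* For an isomorphism class [C] all the orbits in this union coincide
   ([skeleton_classE]). *)
Definition skeleton_class (m : nat) (C : set simplicial_complex) :
    set simplicial_complex :=
  \bigcup_(K in C) iso_orbit (skeleton m K).

Lemma image_complex_comp (s t : S -> S) (K : simplicial_complex) :
  image_complex s (image_complex t K) = image_complex (s \o t) K.
Proof.
apply/complex_eq/seteqP; split => F /=.
  by case=> _ [G KG <-] <-; exists G => //; rewrite image_comp.
by case=> G KG <-; exists (t @` G); [exists G|rewrite image_comp].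
Qed.

Lemma image_complex_id (K : simplicial_complex) : image_complex id K = K.
Proof.
apply/complex_eq/seteqP; split => F /=.
  by case=> G KG <-; rewrite image_id.
by move=> KF; exists F => //; rewrite image_id.
Qed.

Lemma skeleton_image (s : S -> S) (m : nat) (K : simplicial_complex) :
  bijective s ->
  skeleton m (image_complex s K) = image_complex s (skeleton m K).
Proof.
move=> /bij_inj s_inj.
have cardE (F : set S) :
    (s @` F #<= `I_m.+1)%card = (F #<= `I_m.+1)%card.
  by apply: card_le_eql; apply: inj_card_eq => x y _ _; exact: s_inj.
apply/complex_eq/seteqP; split => F /=.
  by case=> -[G KG <-]; rewrite cardE => Gm; exists G.
by case=> G [KG Gm] <-; split; [exists G|rewrite cardE].
Qed.

Lemma iso_orbit_refl (K : simplicial_complex) : iso_orbit K K.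
Proof.
exists id; last exact: image_complex_id.
by exists id.
Qed.

Lemma iso_orbit_eq (K L : simplicial_complex) :
  iso_orbit K L -> iso_orbit L = iso_orbit K.
Proof.
case=> s s_bij <-; apply/seteqP; split => _ [t t_bij <-].
  by exists (t \o s); [exact: bij_comp|rewrite image_complex_comp].
have [s' s's ss'] := s_bij.
exists (t \o s'); first by apply: bij_comp => //; exists s.
rewrite image_complex_comp -compA (_ : s' \o s = id)//.
by apply/funext => x /=; rewrite s's.
Qed.

Lemma skeleton_classE (m : nat) (C : set simplicial_complex)
    (K : simplicial_complex) :
  iso_class C -> C K -> skeleton_class m C = iso_orbit (skeleton m K).
Proof.
case=> L -> LK; apply/seteqP; split => [M [N LN]|M KM]; last by exists K.
suff -> : iso_orbit (skeleton m N) = iso_orbit (skeleton m K) by [].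
rewrite -(iso_orbit_eq LK) in LN; case: LN => s s_bij <-.
rewrite skeleton_image//; apply: iso_orbit_eq.
by exists s.
Qed.

End complexes.
Arguments simplicial_complex : clear implicits.

(* The reals with the Lebesgue sigma-algebra (the completion of the Borel
   one). *)
Definition lebesgueType (R : realType) :=
  caratheodory_type (wlength (@idfun R))^*%mu.

Section random_variables.
Context {R : realType} {S : Type}.
Local Open Scope ereal_scope.

Definition Omega : set (lebesgueType R) := `[0%R, 1%R]%classic.

Definition lambda : {measure set (lebesgueType R) -> \bar R} :=
  @completed_lebesgue_measure R.

(* A measurable map [Omega -> S], where [S] carries the discrete
   sigma-algebra. It is encoded by a function on the whole line, whose values
   outside [Omega] are forgotten in the quotient [rv] below. *)
Record mmap := MMap {
  mmap_fun :> lebesgueType R -> S ;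
  mmap_measurable : forall B : set S, measurable (Omega `&` mmap_fun @^-1` B) }.

HB.instance Definition _ := gen_eqMixin mmap.
HB.instance Definition _ := gen_choiceMixin mmap.

Definition mmap_ae_eq (f g : mmap) : bool :=
  `[< {ae lambda, forall t, Omega t -> f t = g t} >].

Lemma mmap_ae_eq_equiv : equiv_class_of mmap_ae_eq.
Proof.
split=> [f|f g|g f h].
- by apply/asboolP; apply: aeW.
- by apply/idP/idP => /asboolP fg; apply/asboolP;
    apply: filterS fg => t fg /fg.
- move=> /asboolP fg /asboolP gh; apply/asboolP.
  by apply: filterS2 fg gh => t fg gh It; rewrite fg// gh.
Qed.

Canonical mmap_ae_eq_canonical := EquivRelPack mmap_ae_eq_equiv.

Definition rv : Type := {eq_quot mmap_ae_eq}.
HB.instance Definition _ := Choice.on rv.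
HB.instance Definition _ := EqQuotient.on rv.

Definition ess_image (f : mmap) : set S :=
  [set s | 0 < lambda (Omega `&` f @^-1` [set s])].

Definition mmap_dist (f g : mmap) : \bar R :=
  lambda (Omega `&` [set t | f t <> g t]).

Definition L (K : simplicial_complex S) : set rv :=
  [set X | faces K (ess_image (repr X)) /\
           {ae lambda, forall t, Omega t -> ess_image (repr X) (repr X t)}].

Definition rv_dist (X Y : rv) : \bar R := mmap_dist (repr X) (repr Y).

(* [ess_image] and [mmap_dist] are invariant under almost everywhere equality,
   so that [L] and [rv_dist] do not depend on the representatives. *)
Lemma lambda_ae_sub (A B : set (lebesgueType R)) :
  {ae lambda, forall t, A t -> B t} -> lambda A <= lambda B.
Proof.
case=> N [mN N0 subN].
apply: (@le_trans _ _ (lambda (B `|` N))).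
  apply: le_outer_measure => t At; have [Bt|nBt] := pselect (B t); first by left.
  by right; apply: subN => /(_ At).
apply: le_trans (outer_measureU2 (wlength (@idfun R))^*%mu B N) _.
by rewrite [X in _ + X]N0 adde0.
Qed.

Lemma ess_image_ae_eq (f g : mmap) :
  {ae lambda, forall t, Omega t -> f t = g t} -> ess_image f = ess_image g.
Proof.
have sub (f' g' : mmap) : {ae lambda, forall t, Omega t -> f' t = g' t} ->
    ess_image f' `<=` ess_image g'.
  move=> fg s; rewrite /ess_image /= => /lt_le_trans; apply.
  by apply: lambda_ae_sub; apply: filterS fg => t fg [It <-]; split => //=;
    rewrite fg.
move=> fg; apply/seteqP; split; apply: sub => //.
by apply: filterS fg => t fg /fg.
Qed.

Lemma mmap_dist_ae_eq (f f' g g' : mmap) :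
  {ae lambda, forall t, Omega t -> f t = f' t} ->
  {ae lambda, forall t, Omega t -> g t = g' t} ->
  mmap_dist f g = mmap_dist f' g'.
Proof.
move=> ff' gg'; apply/eqP; rewrite eq_le; apply/andP; split;
  apply: lambda_ae_sub; apply: filterS2 ff' gg' => t ff' gg' [It /= fgt];
  split => //=; [rewrite -ff'// -gg'//|rewrite ff'// gg'//].
Qed.

Lemma rv_piP (f : mmap) :
  {ae lambda, forall t, Omega t -> repr (\pi_rv f) t = f t}.
Proof.
apply/asboolP; rewrite -/(mmap_ae_eq _ _).
by have /eqmodP := reprK (\pi_rv f).
Qed.

Lemma L_piE (K : simplicial_complex S) (f : mmap) :
  L K (\pi_rv f) <-> faces K (ess_image f) /\
                     {ae lambda, forall t, Omega t -> ess_image f (f t)}.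
Proof.
have rf := rv_piP f; rewrite /L /= (ess_image_ae_eq rf).
split => -[Kf fim]; split => //; apply: filterS2 rf fim => t rf fim It.
  by rewrite -rf//; exact: fim.
by rewrite rf//; exact: fim.
Qed.

Lemma rv_dist_piE (f g : mmap) :
  rv_dist (\pi_rv f) (\pi_rv g) = mmap_dist f g.
Proof. by apply: mmap_dist_ae_eq; exact: rv_piP. Qed.

Definition excess (K1 K2 : simplicial_complex S) : \bar R :=
  ereal_sup [set ereal_inf [set rv_dist X Y | Y in L K2] | X in L K1].

Definition complex_dist (K1 K2 : simplicial_complex S) : \bar R :=
  maxe (excess K1 K2) (excess K2 K1).

Definition class_dist (C1 C2 : set (simplicial_complex S)) : \bar R :=
  ereal_inf [set complex_dist K1 K2 | K1 in C1 & K2 in C2].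

End random_variables.
Arguments mmap : clear implicits.
Arguments rv : clear implicits.
Arguments L R {S} K.
Arguments excess R {S} K1 K2.
Arguments complex_dist R {S} K1 K2.
Arguments class_dist R {S} C1 C2.

(* Main.v *)
Require Import Defs.
From mathcomp Require Import all_boot all_order all_algebra.
From mathcomp Require Import all_classical all_reals all_analysis.
From mathcomp Require Import generic_quotient.

(** Suppose that [F] has at most [k] points and is a face of [K] but not of
    [K']. Cut the unit interval into [k] pieces of length [1 / k] and let [f]
    take each value in [F] on at least one of them, and no value outside [F]:
    this is an element of [L(K)], since its essential image is [F]
    ([ess_image_equistep]). The essential image of a [g] in [L(K')] is a face
    of [K'], so that it cannot contain [F]; hence [g] avoids almost surely some
    [s] in [F], and it differs from [f] almost everywhere on a piece on which
    [f] is [s] ([le_mmap_dist]). Therefore [d(f, g) >= 1 / k] and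
    [delta(K, K') >= 1 / k] ([excess_ge]).

    If the skeletons of dimension [n + 1] of two isomorphism classes differ,
    then so do the skeletons of any two representatives, and a face lying in
    one of them only is such an [F], in one direction or the other, with
    [k = n + 2]. *)

Local Open Scope classical_set_scope.
Local Open Scope ring_scope.
Local Open Scope ereal_scope.

Import Order.TTheory GRing.Theory Num.Theory.

Section equistep.
Local Open Scope quotient_scope.
Set Implicit Arguments.
Unset Strict Implicit.

(** The enumeration has repetitions when [F] has fewer than [k] points. The
    terms of index at least [k] are kept in [F] so that every map of the form
    [e \o h] has its values in [F]. *)
Lemma card_le_enum (T : Type) (F : set T) (k : nat) :
  F !=set0 -> (F #<= `I_k)%card ->
  exists e : nat -> T, range e `<=` F /\ F `<=` e @` `I_k.
Proof.
move=> [a Fa] /pcard_leP[f].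
have /boolp.choice[e eP] : forall i, exists x,
    F x /\ forall s, F s -> f s = i -> x = s.
  move=> i; have [[s [Fs <-]]|nfi] := pselect (exists s, F s /\ f s = i).
    by exists s; split => // s' Fs' fs; apply: (@inj _ _ _ f); rewrite ?inE.
  by exists a; split => // s Fs fs; case: nfi; exists s.
exists e; split => [_ [i _ <-]|s Fs]; first by have [] := eP i.
by exists (f s); [exact: funS|exact: (eP (f s)).2].
Qed.

Context {R : realType} {S : Type}.

Lemma measurable_lebesgueType_itv (i : interval R) :
  measurable ([set` i] : set (lebesgueType R)).
Proof. by apply: sub_caratheodory; exact: measurable_itv. Qed.

Lemma truncn_cell (k i : nat) (t : R) : (0 <= t)%R ->
  (Num.truncn (k.+1%:R * t) == i) =
  (i%:R / k.+1%:R <= t < i.+1%:R / k.+1%:R)%R.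
Proof.
by move=> t0; rewrite truncn_eq ?mulr_ge0// ler_pdivrMr// ltr_pdivlMr//
  (mulrC t).
Qed.

Lemma measurable_equistep (k : nat) (e : nat -> S) (B : set S) :
  measurable ((@Omega R) `&`
    (fun t : lebesgueType R => e (Num.truncn (k.+1%:R * t))) @^-1` B).
Proof.
rewrite (_ : _ `&` _ = \bigcup_(i in e @^-1` B)
    (Omega `&` [set` `[i%:R / k.+1%:R, i.+1%:R / k.+1%:R[%R])).
  by apply: bigcup_measurable => i _; apply: measurableI;
    exact: measurable_lebesgueType_itv.
apply/seteqP; split => t /=.
  move=> [Ot Bt]; exists (Num.truncn (k.+1%:R * t)) => //; split => //=.
  rewrite in_itv/= -truncn_cell//.
  by move: Ot; rewrite /Omega/= in_itv => /andP[].
move=> [i Bi [Ot /=]]; rewrite in_itv/= -truncn_cell.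
  by move=> /eqP ->.
by move: Ot; rewrite /Omega/= in_itv => /andP[].
Qed.

(** On each of the [k.+1] consecutive cells of length [1 / k.+1] the value is
    the corresponding term of [e]; the point [1] alone is sent to
    [e k.+1]. *)
Definition equistep (k : nat) (e : nat -> S) : mmap R S :=
  MMap (measurable_equistep k e).

Lemma lambda_equistep_ge (k : nat) (e : nat -> S) (i : nat) : (i < k.+1)%N ->
  (k.+1%:R^-1)%:E <= lambda (Omega `&` equistep k e @^-1` [set e i]).
Proof.
move=> ik; pose I := `[(i%:R / k.+1%:R)%R, (i.+1%:R / k.+1%:R)%R[ : interval R.
have -> : (k.+1%:R^-1)%:E = lambda ([set` I] : set (lebesgueType R)).
  rewrite [RHS](lebesgue_measure_itv I)/= lte_fin ltr_pM2r ?invr_gt0//.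
  rewrite ltr_nat ltnSn -EFinD; congr EFin.
  by rewrite -mulrBl -natrB// subSnn mul1r.
apply: lambda_ae_sub; apply: aeW => t; rewrite /I/= in_itv/= => tI.
have t0 : (0 <= t)%R by case/andP: tI => + _; apply: le_trans; rewrite divr_ge0.
split; last by congr e; apply/eqP; rewrite truncn_cell.
rewrite /Omega/= in_itv/= t0/=; case/andP: tI => _ /ltW /le_trans; apply.
by rewrite ler_pdivrMr// mul1r ler_nat.
Qed.

Lemma ess_image_equistep (k : nat) (e : nat -> S) (F : set S) :
  range e `<=` F -> F `<=` e @` `I_k.+1 -> ess_image (equistep k e) = F.
Proof.
move=> eF Fe; apply/seteqP; split => s; rewrite /ess_image/=.
  apply: contraPP => nFs; rewrite (_ : _ `&` _ = set0) ?measure0 ?ltxx//.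
  apply/seteqP; split => // t [_ /= es]; apply: nFs.
  by rewrite -es; apply: eF; eexists.
move=> /Fe[i ik <-]; apply: lt_le_trans (lambda_equistep_ge e ik).
by rewrite lte_fin invr_gt0.
Qed.

(** Where [f] is [s], the two maps agree only if [g] is [s] too, and this
    happens on a null set. *)
Lemma le_mmap_dist (f g : mmap R S) (s : S) : ~ ess_image g s ->
  lambda (Omega `&` f @^-1` [set s]) <= mmap_dist f g.
Proof.
rewrite /ess_image/= => /negP; rewrite lt_neqAle measure_ge0 andbT negbK.
move=> /eqP g0.
apply: lambda_ae_sub; exists (Omega `&` g @^-1` [set s]); split => //.
  exact: mmap_measurable.
move=> t /= /not_implyP[[Ot fs] /not_andP[//|/contrapT fg]].
by split => //=; rewrite -fg.
Qed.

(** The test map is the step map on [F]. The faces of [K'] are closed under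
    passing to subsets, so that every element of [L(K')] misses a point of
    [F]. *)
Lemma excess_ge (K K' : simplicial_complex S) (k : nat) (F : set S) :
  faces K F -> ~ faces K' F -> (F #<= `I_k.+1)%card ->
  (k.+1%:R^-1)%:E <= excess R K K'.
Proof.
move=> KF nK'F Fk; have [_ F0] := face_fin_neq0 KF.
have [e [eF Fe]] := card_le_enum F0 Fk.
have imf := ess_image_equistep eF Fe.
apply: (@le_trans _ _ (ereal_inf
  [set rv_dist (\pi_(rv R S) (equistep k e)) Y | Y in L R K'])).
  apply: le_ereal_inf_tmp => _ [Y [K'Y _] <-].
  rewrite -[Y]reprK rv_dist_piE.
  have [s Fs ns] : exists2 s, F s & ~ ess_image (repr Y) s.
    apply: contrapT => /forall2NP sub; apply: nK'F.
    by apply: face_sub K'Y _ F0 => s Fs; have [//|/contrapT] := sub s.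
  apply: le_trans (le_mmap_dist _ ns).
  by have [i ik <-] := Fe _ Fs; exact: lambda_equistep_ge.
apply: ereal_sup_ubound; exists (\pi_(rv R S) (equistep k e)) => //.
apply/L_piE; rewrite imf; split => //; apply: aeW => t _.
by apply: eF; eexists.
Qed.

End equistep.

Theorem proposition4p5 (R : realType) (S : Type)
    (K1 K2 : set (simplicial_complex S)) (n : nat) :
  iso_class K1 -> iso_class K2 ->
  skeleton_class n.+1 K1 <> skeleton_class n.+1 K2 ->
  ((n + 2)%:R^-1)%:E <= class_dist R K1 K2.
Proof.
move=> isoK1 isoK2 skK12; rewrite addn2.
apply: le_ereal_inf_tmp => _ [K KK1] [L LK2] <-.
rewrite /complex_dist le_max; apply/orP; apply: contrapT => /not_orP[KL LK].
apply: skK12.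
rewrite (skeleton_classE _ isoK1 KK1) (skeleton_classE _ isoK2 LK2).
congr iso_orbit; apply/complex_eq/seteqP.
by split => F [KF Fn]; split => //; apply: contrapT => nF;
  [apply: KL|apply: LK]; exact: excess_ge nF Fn.
Qed.
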